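(* Let $X$ be a Banach space with separable dual $X^*$ and let $M=(M(t,A):t\ge 0,A\in\mathcal A)$ be a cylindrical orthogonal martingale-valued measure on $X^*$ with family of intensity measures $(\nu_{x^*}:x^*\in X^* )$. Let $(x_n^* )_{n\ge 1}$ be a dense subset of the unit sphere of $X^*$ and let $\mu=\sup_{n\ge 1}\nu_{x_n^*}$ (supremum of measures). Assume: (i) for every $t\ge 0$ and $A\in\mathcal A$, $\mathbb P$-a.e. $\mu([0,t]\times A)<\infty$; (ii) $(\nu_{x^*}:x^*\in X^* )$ satisfies the sequential boundedness property. Then $\mu$ is a quadratic variation for $M$. In particular, the quadratic variation is unique: any quadratic variation of $M$ equals $\mu$ $\mathbb P$-a.e.
   Context: $(\Omega,\mathcal F,\mathbb P)$ is a complete probability space with a filtration $(\mathcal F_t)_{t\ge0}$ satisfying the usual conditions. $U$ is a Hausdorff topological space homeomorphic to a Borel subset of $\mathbb R$ (Lusin) and $\mathcal A$ is a ring of Borel subsets of $U$. For square integrable real martingales $Y,Z$, $\langle Y,Z\rangle$ is the predictable quadratic covariation (the unique predictable finite-variation process null at $0$ such that $YZ-\langle Y,Z\rangle$ is a martingale), and $\langle Y\rangle=\langle Y,Y\rangle$. A set function $N:\Omega\times\mathcal A\to\mathbb R$ is a $\sigma$-finite $L^2$-valued measure if: (1) $\mathbb E|N(A)|^2<\infty$ for all $A\in\mathcal A$; (2) $N(A\cup B)=N(A)+N(B)$ $\mathbb P$-a.e. for disjoint $A,B\in\mathcal A$; (3) there is a sequence $(U_n)$ in $\mathcal B(U)$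 with $U_n\uparrow U$, $\mathcal B(U_n)\subseteq\mathcal A$ and $\sup_{A\in\mathcal B(U_n)}\mathbb E|N(A)|^2<\infty$ for each $n$; (4) for each $n$ and each sequence $(A_j)$ in $\mathcal B(U_n)$ decreasing to $\emptyset$, $\mathbb E|N(A_j)|^2\to0$; (5) for each $A\in\mathcal A$, $N(A)$ is the $L^2$-limit of $N(A\cap U_n)$. A cylindrical random variable on $X$ is a continuous linear map $X^*\to L^0(\Omega,\mathcal F,\mathbb P)$ (with convergence in probability). A cylindrical orthogonal martingale-valued measure on $X^*$ is a collection $M=(M(t,A):t\ge0,A\in\mathcal A)$ of cylindrical random variables on $X$ such that: (i) $M(0,A)(x^* )=0$ $\mathbb P$-a.e. for all $A,x^*$; (ii) for each $A$ and $x^*$, $M(A)(x^* )=(M(t,A)(x^* ))_{t\ge0}$ is a real càdlàg mean-zero square integrable martingale, and each $M(t,A):X^*\to L^0$ is continuous; (iii) for $t>0$ and $x^*\in X^*$, $M(t,\cdot)(x^* )$ is a $\sigma$-finite $L^2$-valued measure; (iv) $\langle M(A)(x^* ),M(B)(x^* )\rangle_t=0$ for $t>0$, $x^*\in X^*$ and disjoint $A,B\in\mathcal A$. A random measure on a measurable space $(S,\Sigma)$ is a map $\mu:\Omega\times\Sigma\to[0,\infty]$ such that $\mu(\cdot,E)$ is measurable for every $E\in\Sigma$ and $\mu(\omega,\cdot)$ is a measure for a.e. $\omega$. Such a random measure on $\mathcal B(\mathbb R_+)\otimes\mathcal B(U)$ is predictable if $(\omega,t)\mapsto\mu(\omega)([0,t]\times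 B)$ is predictable for each $B\in\mathcal B(U)$. The intensity measure $\nu_{x^*}$ is the unique predictable $\sigma$-finite random measure on $\mathcal B(\mathbb R_+)\otimes\mathcal B(U)$ with $\nu_{x^*}([0,t]\times A)=\langle M(A)(x^* )\rangle_t$ $\mathbb P$-a.e. for every $t\ge0$, $A\in\mathcal A$. For measures, $\nu\le\mu$ means $\nu(C)\le\mu(C)$ for all measurable $C$; for random measures, $\eta\le\zeta$ means $\eta(\omega)\le\zeta(\omega)$ for $\mathbb P$-a.e. $\omega$. The supremum $\sup_\alpha\mu_\alpha$ of a family of measures is the smallest measure dominating all $\mu_\alpha$; explicitly $(\sup_\alpha\mu_\alpha)(A)=\sup_{\Pi}\sum_{C\in\Pi}\sup_\alpha\mu_\alpha(C)$ over finite measurable partitions $\Pi$ of $A$. For random measures it is taken for each $\omega$. $M$ has a quadratic variation $\eta$ if $\eta$ is a random measure on $\mathcal B(\mathbb R_+)\otimes\mathcal B(U)$ such that: (a) for every $t\ge0$, $A\in\mathcal A$, $\eta([0,t]\times A)<\infty$ $\mathbb P$-a.e.; (b) $\eta$ is a minimal element (for $\le$) of the collection of all random measures $\zeta$ with $\nu_{x^*}\le\zeta$ for every $x^*\in X^*$ with $\|x^*\|=1$. The family $(\nu_{x^*})$ satisfies the sequential boundedness property if whenever $(x_n^* )$ is dense in the unit sphere of $X^*$, $\|x^*\|=1$ and $t>0$, there is $\Omega_{x^*}\subseteq\Omega$ with $\mathbb P(\Omega_{x^*})=1$ such that for all $0\le s<t$, $A\in\mathcal A$, $\omega\in\Omega_{x^*}$: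 $\nu_{x^*}(\omega)((s,t]\times A)\le\sup_{n\ge1}\nu_{x_n^*}(\omega)((s,t]\times A)$ (supremum of numbers in $[0,\infty]$). *)

(* Defs.v *)
From HB Require Import structures.
From mathcomp Require Import all_boot all_order all_algebra.
From mathcomp Require Import all_classical all_reals all_analysis.
From mathcomp Require Import measurable_realfun.

Set Implicit Arguments.
Unset Strict Implicit.
Unset Printing Implicit Defensive.
Import Order.TTheory GRing.Theory Num.Theory.
Import numFieldNormedType.Exports.
Local Open Scope classical_set_scope.
Local Open Scope ring_scope.

Section dual_space.
Context {R : realType} (X : normedModType R).

Definition is_dual_fun : {pred X -> R^o} :=
  fun f => `[< linear f /\ continuous f >].

Record dual := Dual { dual_val :> X -> R^o ; _ : dual_val \in is_dual_fun }.

HB.instance Definition _ := [isSub for dual_val].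
HB.instance Definition _ := gen_eqMixin dual.
HB.instance Definition _ := gen_choiceMixin dual.

Lemma is_dual_funP f : reflect (linear f /\ continuous f) (f \in is_dual_fun).
Proof. exact: asboolP. Qed.

Lemma is_dual_fun_submod_closed : submod_closed is_dual_fun.
Proof.
split.
  by apply/is_dual_funP; split=> [a u v|x]; [rewrite scaler0 addr0|exact: cvg_cst].
move=> a f g /is_dual_funP[lf cf] /is_dual_funP[lg cg]; apply/is_dual_funP; split.
  move=> b u v; rewrite !fctE lf lg !scalerDr !scalerA (mulrC a b).
  by rewrite addrACA.
move=> x; apply: cvgD; last exact: cg.
by apply: cvgZr; exact: cf.
Qed.

HB.instance Definition _ :=
  GRing.isSubmodClosed.Build _ _ is_dual_fun is_dual_fun_submod_closed.
HB.instance Definition _ := [SubChoice_isSubLmodule of dual by <:].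

Definition dual_norm (f : dual) : R :=
  sup [set `|f x| | x in [set x : X | `|x| <= 1]].

Lemma dual_norm_has_sup (f : dual) :
  has_sup [set `|f x| | x in [set x : X | `|x| <= 1]].
Proof.
case: f => f /[dup] /is_dual_funP[lf cf] If /=; split.
  by exists `|f 0|, 0 => //=; rewrite normr0.
pose lfM := GRing.isLinear.Build R X R^o *:%R f lf.
pose F : {linear X -> R^o} := HB.pack f lfM.
have /bounded_funP/(_ 1)[M HM] : bounded_near F (nbhs (0 : X)).
  exact/linear_bounded_continuous.
by exists M => _ [x x1 <-]; exact: HM.
Qed.

Lemma dual_linear (f : dual) : linear f.
Proof. by case: f => f /[dup] /is_dual_funP[]. Qed.

Lemma dual_norm_ub (f : dual) x : `|x| <= 1 -> `|f x| <= dual_norm f.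
Proof.
move=> x1; apply: sup_upper_bound; first exact: dual_norm_has_sup.
by exists x.
Qed.

Lemma dual_norm_le (f : dual) M :
  (forall x, `|x| <= 1 -> `|f x| <= M) -> dual_norm f <= M.
Proof.
move=> H; apply: ge_sup; first by have [] := dual_norm_has_sup f.
by move=> _ [x x1 <-]; exact: H.
Qed.

Lemma dual_normD (f g : dual) : dual_norm (f + g) <= dual_norm f + dual_norm g.
Proof.
apply: dual_norm_le => x x1; apply: le_trans (ler_normD _ _) _.
by apply: lerD; exact: dual_norm_ub.
Qed.

Lemma dual_normZ (a : R) (f : dual) : dual_norm (a *: f) = `|a| * dual_norm f.
Proof.
have le b (g : dual) : dual_norm (b *: g) <= `|b| * dual_norm g.
  apply: dual_norm_le => x x1.
  rewrite (_ : (b *: g) x = b * g x)// normrM.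
  by apply: ler_wpM2l => //; exact: dual_norm_ub.
apply/eqP; rewrite eq_le le/=.
have [->|a0] := eqVneq a 0.
  rewrite normr0 mul0r; apply: le_trans (dual_norm_ub (0 *: f) (x := 0) _).
    exact: normr_ge0.
  by rewrite normr0.
rewrite -ler_pdivlMl ?normr_gt0// -normfV.
by apply: le_trans (le _ _); rewrite scalerA mulVf// scale1r.
Qed.

Lemma dual_norm_eq0 (f : dual) : dual_norm f = 0 -> f = 0.
Proof.
move=> f0; apply: val_inj; apply/funext => x /=.
have fl := dual_linear f.
pose fM := GRing.isLinear.Build R X R^o *:%R f fl.
pose F : {linear X -> R^o} := HB.pack (dual_val f) fM.
have f_unit y : `|y| <= 1 -> F y = 0.
  by move=> /(dual_norm_ub f); rewrite f0 normr_le0 => /eqP.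
have [->|x0] := eqVneq x 0; first exact: (linear0 F).
have nx : `|x| != 0 by rewrite normr_eq0.
have : F (`|x|^-1 *: x) = 0.
  by apply: f_unit; rewrite normrZ normfV normr_id mulVf.
rewrite linearZ /= => /eqP; rewrite scaler_eq0 invr_eq0 (negbTE nx) /=.
by move=> /eqP.
Qed.

HB.instance Definition _ :=
  Lmodule_isNormed.Build R dual dual_normD dual_normZ dual_norm_eq0.

End dual_space.

Definition separable (T : topologicalType) :=
  exists D : set T, countable D /\ dense D.

(* [0, +oo[ with the trace of the Borel sigma-algebra of R. *)
Definition Rplus (R : realType) : Type := {nonneg R}.

Section Rplus_instances.
Context (R : realType).

HB.instance Definition _ := Order.Total.on (Rplus R).

Definition Rplus0 : Rplus R := (0%:nng : {nonneg R}).

HB.instance Definition _ := isPointed.Build (Rplus R) Rplus0.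

Definition Rplus_val (t : Rplus R) : R := (t : {nonneg R})%:num.

HB.instance Definition _ := Measurable.copy (Rplus R)
  (g_sigma_algebra_preimageType Rplus_val).

End Rplus_instances.

Arguments Rplus0 {R}.

Definition borel (V : ptopologicalType) := g_sigma_algebraType (@open V).

Section stochastic_processes.
Context {d : measure_display} {Omega : measurableType d} {R : realType}.
Variables (P : probability Omega R) (F : Rplus R -> set (set Omega)).

Definition measurable_wrt {T : Type} {d' : measure_display}
    {S : measurableType d'} (G : set (set T)) (f : T -> S) :=
  forall B, measurable B -> G (f @^-1` B).

Definition is_filtration :=
  (forall t, sigma_algebra setT (F t) /\ F t `<=` measurable) /\
  {homo F : s t / s <= t >-> s `<=` t}.

Definition usual_conditions :=
  P.-negligible `<=` F Rplus0 /\
  forall t, F t = \bigcap_(s in [set s | t < s]) F s.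

Definition process := Rplus R -> Omega -> R.

(* The path t |-> Y t w, read on R through t |-> `|t| so that the one-sided
   limits and total variations of real functions apply; only its values on
   [0, +oo[ are ever used. *)
Definition sample_path (Y : process) (w : Omega) : R -> R :=
  fun r => Y (`|r|%:nng : {nonneg R}) w.

Definition cadlag_path (f : R -> R) :=
  (forall t, 0 <= t -> f r @[r --> t^'+] --> f t) /\
  (forall t, 0 < t -> cvg (f r @[r --> t^'-])).

Definition cadlag (Y : process) := {ae P, forall w, cadlag_path (sample_path Y w)}.

Definition adapted (Y : process) := forall t, measurable_wrt (F t) (Y t).

Definition is_cond_expectation (G : set (set Omega)) (Y Z : Omega -> R) :=
  [/\ measurable_wrt G Z, P.-integrable setT (EFin \o Z) &
      forall E, G E -> (\int[P]_(w in E) (Z w)%:E = \int[P]_(w in E) (Y w)%:E)%E].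

Definition martingale (Y : process) :=
  [/\ adapted Y,
      forall t, P.-integrable setT (EFin \o Y t) &
      forall s t, s <= t -> is_cond_expectation (F s) (Y t) (Y s)].

Definition second_moment (Z : Omega -> R) : \bar R := ('E_P[fun w => (Z w ^+ 2)%R])%E.

Definition square_integrable (Y : process) :=
  forall t, (second_moment (Y t) < +oo)%E.

Definition predictable_rectangles : set (set (Omega * Rplus R)) :=
  [set E `*` [set Rplus0] | E in F Rplus0] `|`
  [set C | exists s t E, [/\ s < t, F s E &
             C = E `*` [set r : Rplus R | s < r <= t]]].

Definition predictable_sigma_algebra : set (set (Omega * Rplus R)) :=
  <<s predictable_rectangles >>.

Definition predictable {d' : measure_display} {S : measurableType d'}
    (Y : Rplus R -> Omega -> S) :=
  measurable_wrt predictable_sigma_algebra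
    (fun p : Omega * Rplus R => Y p.2 p.1).

Definition finite_variation (V : process) :=
  cadlag V /\
  {ae P, forall w, forall t : R, 0 <= t -> bounded_variation 0 t (sample_path V w)}.

(* V is (a version of) <Y, Z>. *)
Definition is_covariation (Y Z V : process) :=
  [/\ predictable V, finite_variation V,
      {ae P, forall w, V Rplus0 w = 0} &
      martingale (fun t w => Y t w * Z t w - V t w)].

End stochastic_processes.

Section random_measures.
Context {d d' : measure_display} {Omega : measurableType d}
  {S : measurableType d'} {R : realType} (P : probability Omega R).

Definition random_measure (mu : Omega -> set S -> \bar R) :=
  [/\ forall w E, measurable E -> (0 <= mu w E)%E,
      forall E, measurable E -> measurable_fun setT (mu ^~ E) &
      {ae P, forall w, exists m : {measure set S -> \bar R},
        forall E, measurable E -> mu w E = m E}].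

Definition random_measure_le (eta zeta : Omega -> set S -> \bar R) :=
  {ae P, forall w, forall C, measurable C -> (eta w C <= zeta w C)%E}.

Definition random_measure_eq (eta zeta : Omega -> set S -> \bar R) :=
  {ae P, forall w, forall C, measurable C -> eta w C = zeta w C}.

Definition sup_measure {I : Type} (mu : I -> set S -> \bar R) (A : set S) :
    \bar R :=
  ereal_sup [set s | exists n (C : 'I_n -> set S),
    [/\ forall i, measurable (C i), trivIset setT C, \bigcup_i C i = A &
        s = (\sum_(i < n) ereal_sup (range (fun a => mu a (C i))))%E]].

End random_measures.

Section martingale_valued_measures.
Context {d : measure_display} {Omega : measurableType d} {R : realType}.
Variables (P : probability Omega R) (F : Rplus R -> set (set Omega)).
Context {U : ptopologicalType} (A : set (set U)).

Definition homeomorphic_to_Borel_subset_of_R :=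
  exists (f : U -> R) (g : R -> U),
    [/\ measurable (range f), continuous f,
        {within range f, continuous g} & cancel f g].

Definition ring_of_Borel_sets := setring A /\ A `<=` (<<s @open U >>).

Definition L2_bounded_exhaustion (N : set U -> Omega -> R) (Un : (set U)^nat) :=
  [/\ forall n, <<s @open U >> (Un n),
      nondecreasing_seq Un /\ \bigcup_n Un n = setT,
      forall n B, <<s @open U >> B -> B `<=` Un n -> A B &
      forall n, (ereal_sup [set second_moment P (N B) |
                   B in [set B | <<s @open U >> B /\ B `<=` Un n]] < +oo)%E].

(* One exhausting sequence Un serves boundedness, continuity at the empty set and
   approximation. *)
Definition sigma_finite_L2_measure (N : set U -> Omega -> R) :=
  [/\ forall B, A B -> measurable_fun setT (N B) /\
        (second_moment P (N B) < +oo)%E,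
      forall B C, A B -> A C -> B `&` C = set0 ->
        {ae P, forall w, N (B `|` C) w = N B w + N C w} &
      exists Un : (set U)^nat,
        [/\ L2_bounded_exhaustion N Un,
            forall n (B : (set U)^nat),
              (forall j, <<s @open U >> (B j) /\ B j `<=` Un n) ->
              nonincreasing_seq B -> \bigcap_j B j = set0 ->
              second_moment P (N (B j)) @[j --> \oo] --> 0%E &
            forall B, A B ->
              second_moment P (N (B `&` Un n) \- N B)
                @[n --> \oo] --> 0%E]].

Context {X : completeNormedModType R}.

(* Elements of L^0 are given by representatives, so linearity holds P-a.e.;
   continuity is for convergence in probability. *)
Definition cylindrical_rv (Z : dual X -> Omega -> R) :=
  [/\ forall x, measurable_fun setT (Z x),
      forall (a : R) x y, {ae P, forall w, Z (a *: x + y) w = a * Z x w + Z y w} &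
      forall x (e : R), 0 < e ->
        P [set w | e <= `|Z y w - Z x w|] @[y --> x] --> 0%E].

Definition cylindrical_orthogonal_mvm
    (M : Rplus R -> set U -> dual X -> Omega -> R) :=
  [/\ forall t B, A B -> cylindrical_rv (M t B),
      forall B x, A B -> {ae P, forall w, M Rplus0 B x w = 0},
      forall B x, A B ->
        [/\ martingale P F (fun t => M t B x), cadlag P (fun t => M t B x),
            square_integrable P (fun t => M t B x) &
            forall t, ('E_P[M t B x] = 0)%E],
      forall t x, Rplus0 < t -> sigma_finite_L2_measure (fun B => M t B x) &
      forall x B C, A B -> A C -> B `&` C = set0 ->
        exists2 V, is_covariation P F (fun t => M t B x) (fun t => M t C x) V &
          forall t, Rplus0 < t -> {ae P, forall w, V t w = 0}].

Definition box (s t : Rplus R) (B : set U) : set (Rplus R * borel U) :=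
  [set r | s < r <= t] `*` B.

Definition box0 (t : Rplus R) (B : set U) : set (Rplus R * borel U) :=
  [set r | r <= t] `*` B.

Definition predictable_random_measure
    (mu : Omega -> set (Rplus R * borel U) -> \bar R) :=
  forall B, <<s @open U >> B -> predictable F (fun t w => mu w (box0 t B)).

Definition is_intensity_measure (M : Rplus R -> set U -> dual X -> Omega -> R)
    (x : dual X) (nu : Omega -> set (Rplus R * borel U) -> \bar R) :=
  [/\ random_measure P nu, predictable_random_measure nu,
      {ae P, forall w, sigma_finite setT (nu w)} &
      forall B, A B ->
        exists2 V, is_covariation P F (fun t => M t B x) (fun t => M t B x) V &
          forall t, {ae P, forall w, nu w (box0 t B) = (V t w)%:E}].

(* nu is the family of intensity measures of M. *)
Definition is_quadratic_variation
    (nu : dual X -> Omega -> set (Rplus R * borel U) -> \bar R)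
    (eta : Omega -> set (Rplus R * borel U) -> \bar R) :=
  let dominating zeta := random_measure P zeta /\
    forall x : dual X, `|x| = 1 -> random_measure_le P (nu x) zeta in
  [/\ forall t B, A B -> {ae P, forall w, (eta w (box0 t B) < +oo)%E},
      dominating eta &
      forall zeta, dominating zeta -> random_measure_le P zeta eta ->
        random_measure_le P eta zeta].

Definition dense_in_dual_sphere (x : (dual X)^nat) :=
  (forall n, `|x n| = 1) /\ [set y : dual X | `|y| = 1] `<=` closure (range x).

Definition sequentially_bounded
    (nu : dual X -> Omega -> set (Rplus R * borel U) -> \bar R) :=
  forall (xn : (dual X)^nat) (x : dual X) (t : Rplus R),
    dense_in_dual_sphere xn -> `|x| = 1 -> Rplus0 < t ->
    exists Omega_x : set Omega,
      [/\ measurable Omega_x, P Omega_x = 1%E &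
          forall s B w, s < t -> A B -> Omega_x w ->
            (nu x w (box s t B) <= ereal_sup (range (fun n => nu (xn n) w (box s t B))))%E].

End martingale_valued_measures.

Arguments homeomorphic_to_Borel_subset_of_R : clear implicits.

(* Main.v *)
Require Import Defs.
From HB Require Import structures.
From mathcomp Require Import all_boot all_order all_algebra.
From mathcomp Require Import all_classical all_reals all_analysis.
From mathcomp Require Import measurable_realfun.

(** The supremum of a sequence of measures is a measure, and it lies below every
measure dominating all of them; this gives minimality and uniqueness. The other two
points rest on one approximation: the sigma-algebra of [R_+ x U] is generated by
countably many sets [{r <= |q|}] and [{f u <= q}] ([q] rational, [f] an embedding of
[U] into the line), so, inside a set of finite mass, a measurable set is as close as
desired to a finite boolean combination of generators.

Measurability in [omega] of the supremum: on a set of finite mass, the uncountably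
many partitions can be replaced by the countably many ones made of such boolean
combinations; the exceptional null set is harmless since [P] is complete.

Domination of [nu_x] for [x] in the unit sphere: sequential boundedness compares
[nu_x] and [mu] on the boxes [(s, t] x B] with [t] rational, off a single null set.
Cutting a box by a generator or by its complement gives such a box again, so the
comparison extends to boolean combinations, and to all measurable sets by
approximation. The boxes miss [{0} x U], which is [nu_x]-null because the covariation
starts at [0]. *)

Set Implicit Arguments.
Unset Strict Implicit.
Unset Printing Implicit Defensive.
Import Order.TTheory GRing.Theory Num.Theory.
Import numFieldNormedType.Exports.
Local Open Scope classical_set_scope.
Local Open Scope ring_scope.

(** * The supremum of a sequence of measures *)

Section ereal_sup_sum.
Context {R : realType}.
Local Open Scope ereal_scope.
Implicit Types (A B : set (\bar R)) (x c : \bar R).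

Lemma ereal_sup_addr_le A x c : A !=set0 -> (forall a, A a -> 0 <= a) ->
  0 <= x -> (forall a, A a -> a + x <= c) -> ereal_sup A + x <= c.
Proof.
move=> [a Aa] A0 x0 Ac; have a0 := A0 _ Aa.
have [xfin|] := boolP (x \is a fin_num).
  by rewrite -leeBrDr//; apply: ge_ereal_sup => b Ab; rewrite leeBrDr// Ac.
rewrite ge0_fin_numE// -leNgt leye_eq => /eqP xy.
have := Ac _ Aa; rewrite xy addey; last by rewrite gt_eqF// (lt_le_trans _ a0).
by rewrite leye_eq => /eqP ->; rewrite leey.
Qed.

Lemma ereal_sup_add_le A B c : A !=set0 -> B !=set0 ->
  (forall a, A a -> 0 <= a) -> (forall b, B b -> 0 <= b) ->
  (forall a b, A a -> B b -> a + b <= c) -> ereal_sup A + ereal_sup B <= c.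
Proof.
move=> A0 [b Bb] Age0 Bge0 ABc; apply: ereal_sup_addr_le => //.
  by apply: le_ereal_sup_tmp; exists b => //; exact: Bge0.
move=> a Aa; rewrite addeC; apply: ereal_sup_addr_le => //; first by exists b.
  exact: Age0.
by move=> b' Bb'; rewrite addeC; exact: ABc.
Qed.

End ereal_sup_sum.

Section sup_measure_theory.
Context {d : measure_display} {S : measurableType d} {R : realType}.
Local Open Scope ereal_scope.

Lemma eq_sup_measure {I : Type} (m m' : I -> set S -> \bar R) E :
  (forall i E, measurable E -> m i E = m' i E) ->
  sup_measure m E = sup_measure m' E.
Proof.
move=> mm'; have eqC C : measurable C -> (m ^~ C) = (m' ^~ C).
  by move=> mC; apply/funext => k; exact: mm'.
rewrite /sup_measure; congr ereal_sup.
by apply/seteqP; split => _ [n [C [mC tC CE ->]]]; exists n, C; split => //;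
  apply: eq_bigr => i _; rewrite eqC.
Qed.

Lemma sup_measure_ub {I : Type} (m : I -> set S -> \bar R) i E :
  measurable E -> m i E <= sup_measure m E.
Proof.
move=> mE; apply: le_ereal_sup_tmp.
exists (ereal_sup (range (m ^~ E))); last first.
  by apply: ereal_sup_ubound; exists i.
exists 1%N, (fun=> E); split => //; last by rewrite big_ord1.
- by move=> i0 j _ _ _; rewrite (ord1 i0) (ord1 j).
- by rewrite bigcup_const//; exists ord0.
Qed.

(** On a partition of [E], additivity of [z] adds the cellwise bounds up to [z E]; this is the
    leastness of the supremum. *)
Lemma sup_measure_le {I : Type} (m : I -> set S -> \bar R)
    (z : {measure set S -> \bar R}) E :
  (forall i E, measurable E -> m i E <= z E) -> sup_measure m E <= z E.
Proof.
move=> mz; apply: ge_ereal_sup => _ [n [C [mC tC <- ->]]].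
rewrite (_ : \bigcup_i C i = \big[setU/set0]_(i < n) C i); last first.
  by rewrite -(@bigcup_pred _ _ xpredT); apply: eq_bigcupl; split.
rewrite measure_bigsetU_ord//.
apply: lee_sum => i _; apply: ge_ereal_sup => _ [k _ <-]; exact: mz.
Qed.

Variable m : nat -> {measure set S -> \bar R}.

Let supm : set S -> \bar R := sup_measure (fun k => m k : set S -> \bar R).

Let part E := [set s | exists n (C : 'I_n -> set S),
    [/\ forall i, measurable (C i), trivIset setT C, \bigcup_i C i = E &
        s = \sum_(i < n) ereal_sup (range (fun a => m a (C i)))]].

Let cell_ge0 (C : set S) : 0 <= ereal_sup (range (fun a => m a C)).
Proof. by apply: le_ereal_sup_tmp; exists (m 0%N C) => //; exists 0%N. Qed.

Let part_ge0 E s : part E s -> 0 <= s.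
Proof. by move=> [n [C [_ _ _ ->]]]; exact: sume_ge0. Qed.

Let part_neq0 E : measurable E -> part E !=set0.
Proof.
move=> mE; exists (ereal_sup (range (fun k => m k E))); exists 1%N, (fun=> E).
split => //; last by rewrite big_ord1.
- by move=> i j _ _ _; rewrite (ord1 i) (ord1 j).
- by rewrite bigcup_const//; exists ord0.
Qed.

Lemma sup_measure_ge0 E : measurable E -> 0 <= supm E.
Proof.
move=> mE; rewrite /supm.
by apply: le_trans (sup_measure_ub (fun k => m k : set S -> \bar R) 0%N mE).
Qed.

(** A partition of [A] followed by a partition of [B] is a partition of the union, so any two
    partition sums add up to a third. *)
Lemma sup_measure_superadditive A B : measurable A -> measurable B ->
  A `&` B = set0 -> supm A + supm B <= supm (A `|` B).
Proof.
move=> mA mB AB0; apply: ereal_sup_add_le; first exact: part_neq0.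
- exact: part_neq0.
- exact: part_ge0.
- exact: part_ge0.
move=> _ _ [n [C [mC tC CA ->]]] [n' [C' [mC' tC' CB ->]]].
pose D (i : 'I_(n + n')) :=
  match fintype.split i with inl j => C j | inr j => C' j end.
apply: ereal_sup_ubound; exists (n + n')%N, D; split.
- by move=> i; rewrite /D; case: fintype.split.
- have CC' j k : C j `&` C' k = set0.
    rewrite -subset0 -AB0 -CA -CB => x [? ?].
    by split; [exists j|exists k].
  move=> i j _ _; rewrite /D -{2}(splitK i) -{2}(splitK j).
  case: (fintype.split i) => i'; case: (fintype.split j) => j' /=.
  + by move=> /(tC _ _ I I) ->.
  + by rewrite CC' => -[? []].
  + by rewrite setIC CC' => -[? []].
  + by move=> /(tC' _ _ I I) ->.
- rewrite -CA -CB; apply/seteqP; split=> x.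
    by move=> [i _]; rewrite /D; case: fintype.split => j; [left|right]; exists j.
  move=> [|] [j _ Cj].
    by exists (unsplit (inl j)) => //; rewrite /D unsplitK.
  by exists (unsplit (inr j)) => //; rewrite /D unsplitK.
- rewrite big_split_ord/=; congr (_ + _); apply: eq_bigr => j _.
    by rewrite /D (unsplitK (inl j)).
  by rewrite /D (unsplitK (inr j)).
Qed.

Lemma sup_measure_mono A B : measurable A -> measurable B -> A `<=` B ->
  supm A <= supm B.
Proof.
move=> mA mB AB; rewrite -(setDUK AB).
apply: (le_trans _ (sup_measure_superadditive mA (measurableD mB mA) _)).
  by rewrite leeDl// sup_measure_ge0//; exact: measurableD.
by rewrite setDIK.
Qed.

Lemma sup_measure_sum_le (F : (set S)^nat) n : (forall i, measurable (F i)) ->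
  trivIset setT F -> \sum_(i < n) supm (F i) <= supm (\big[setU/set0]_(i < n) F i).
Proof.
move=> mF tF; elim: n => [|n IHn].
  by rewrite !big_ord0 sup_measure_ge0.
rewrite !big_ord_recr/=; apply: le_trans (leeD IHn (lexx _)) _.
apply: sup_measure_superadditive => //; first exact: bigsetU_measurable.
by rewrite -subset0 => x [/=]; rewrite -bigcup_mkord => -[i /= ilt Fi Fn];
  have := tF i n I I (ex_intro _ x (conj Fi Fn)); move: ilt => /[swap] ->; rewrite ltnn.
Qed.

(** A finite partition [C] of the union cuts every [F j] into the traces of the cells [C i].
    Countable additivity of each [m k] bounds the supremum on [C i] by the series of the suprema on
    these traces, and the two sums are exchanged. *)
Lemma sup_measure_sigma_subadditive (F : (set S)^nat) :
  (forall i, measurable (F i)) -> trivIset setT F ->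
  supm (\bigcup_i F i) <= \sum_(0 <= i <oo) supm (F i).
Proof.
move=> mF tF; apply: ge_ereal_sup => _ [n [C [mC tC CF ->]]].
have sub j : supm (F j) >=
    \sum_(i < n) ereal_sup (range (fun a => m a (C i `&` F j))).
  apply: ereal_sup_ubound; exists n, (fun i => C i `&` F j); split => //.
  - by move=> i; exact: measurableI.
  - by move=> i k _ _ [x [[Ci _] [Ck _]]]; apply: (tC i k I I); exists x.
  - rewrite -setI_bigcupl CF; apply/seteqP; split => [x [//]|x Fx].
    by split => //; exists j.
apply: (le_trans _ (lee_nneseries _ (fun j _ => sub j))); last first.
  by move=> j _ _; exact: sume_ge0.
rewrite nneseries_sum//; apply: lee_sum => i _.
apply: ge_ereal_sup => _ [k _ <-].
have {1}-> : C i = \bigcup_j (C i `&` F j).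
  rewrite -setI_bigcupr; apply/esym/setIidPl; rewrite -CF.
  by move=> x Cx; exists i.
rewrite measure_bigcup//=; last 2 first.
  by move=> j _; exact: measurableI.
  by apply: trivIset_setIl.
rewrite (@eq_eseriesl _ _ xpredT) => [|j]; last by rewrite in_setT.
apply: lee_nneseries => // j _.
by apply: ereal_sup_ubound; exists k.
Qed.

(* The supremum over the empty family of partitions is -oo at non-measurable
   sets, hence the truncation at 0. *)
Definition measure_sup E := maxe 0 (supm E).

Lemma measure_supE E : measurable E -> measure_sup E = supm E.
Proof. by move=> mE; rewrite /measure_sup max_r// sup_measure_ge0. Qed.

Let measure_sup0 : measure_sup set0 = 0.
Proof.
rewrite measure_supE//; apply/eqP; rewrite eq_le sup_measure_ge0// andbT.
apply: ge_ereal_sup => _ [n [C [_ _ C0 ->]]].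
rewrite big1// => i _; have -> : C i = set0.
  by rewrite -subset0 -C0 => x Cx; exists i.
by under eq_fun do rewrite measure0; rewrite ereal_sup_cst//; apply/set0P; exists 0%N.
Qed.

Let measure_sup_ge0 E : 0 <= measure_sup E.
Proof. by rewrite le_max lexx. Qed.

Let measure_sup_sigma_additive : semi_sigma_additive measure_sup.
Proof.
move=> F mF tF mUF; rewrite measure_supE//.
under eq_fun do rewrite (eq_bigr _ (fun i _ => measure_supE (mF i))).
have supF0 i : 0 <= supm (F i) by exact: sup_measure_ge0.
(* One inequality is subadditivity; for the other, every partial sum is bounded by finite
   superadditivity and monotonicity. *)
have -> : supm (\bigcup_n F n) = \sum_(0 <= i <oo) supm (F i).
  apply/eqP; rewrite eq_le sup_measure_sigma_subadditive//=.
  apply: lime_le; first exact: is_cvg_nneseries.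
  apply: nearW => n; rewrite big_mkord.
  apply: le_trans (sup_measure_sum_le n mF tF) _; apply: sup_measure_mono => //.
    exact: bigsetU_measurable.
  exact: bigsetU_bigcup.
exact: is_cvg_nneseries.
Qed.

HB.instance Definition _ := isMeasure.Build d S R measure_sup
  measure_sup0 measure_sup_ge0 measure_sup_sigma_additive.

End sup_measure_theory.

(** * The algebra generated by a countable family *)

(** Finite decision trees, a syntax for boolean combinations of sets indexed by [J]. Over a
    countable [J] there are countably many of them, and induction on a tree peels off one generator
    at a time. *)
Inductive dtree (J : Type) := Leaf of bool | Node of J & dtree J & dtree J.
Arguments Leaf {J}.

Section dtree_countable.
Context {J : countType}.

Fixpoint dtree_code (t : dtree J) : GenTree.tree (J + bool)%type :=
  match t with
  | Leaf b => GenTree.Leaf (inr b)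
  | Node i t1 t0 =>
      GenTree.Node 0 [:: GenTree.Leaf (inl i); dtree_code t1; dtree_code t0]
  end.

Fixpoint dtree_decode (c : GenTree.tree (J + bool)%type) : dtree J :=
  match c with
  | GenTree.Leaf (inr b) => Leaf b
  | GenTree.Node _ [:: GenTree.Leaf (inl i); c1; c0] =>
      Node i (dtree_decode c1) (dtree_decode c0)
  | _ => Leaf true
  end.

Lemma dtree_codeK : cancel dtree_code dtree_decode.
Proof. by elim=> //= i t1 -> t0 ->. Qed.

HB.instance Definition _ := Countable.copy (dtree J) (can_type dtree_codeK).

End dtree_countable.

Section dtree_sets.
Context {J S : Type} (g : J -> set S).

(* The sets decided by membership in finitely many of the sets [g i]: these form
   the algebra generated by [g]. *)
Fixpoint dset (t : dtree J) : set S :=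
  match t with
  | Leaf b => if b then setT else set0
  | Node i t1 t0 => (g i `&` dset t1) `|` (dset t0 `\` g i)
  end.

Fixpoint dtree_not (t : dtree J) :=
  match t with
  | Leaf b => Leaf (~~ b)
  | Node i t1 t0 => Node i (dtree_not t1) (dtree_not t0)
  end.

Fixpoint dtree_and (t u : dtree J) :=
  match t with
  | Leaf b => if b then u else Leaf false
  | Node i t1 t0 => Node i (dtree_and t1 u) (dtree_and t0 u)
  end.

Lemma dset_not t : dset (dtree_not t) = ~` dset t.
Proof.
elim: t => [[]/=|i t1 /= -> t0 ->]; rewrite ?setCT ?setC0//.
by apply/seteqP; split => x /=; have [] := pselect (g i x); tauto.
Qed.

Lemma dset_and t u : dset (dtree_and t u) = dset t `&` dset u.
Proof.
elim: t => [[]/=|i t1 /= -> t0 -> ]; rewrite ?setTI ?set0I//.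
by apply/seteqP; split => x /=; tauto.
Qed.

End dtree_sets.

Section dtree_measurable.
Context {d : measure_display} {S : measurableType d} {R : realType} {J : Type}.
Variable g : J -> set S.
Hypothesis mg : forall i, measurable (g i).
Local Open Scope ereal_scope.

Lemma measurable_dset t : measurable (dset g t).
Proof.
elim: t => [[]|i t1 m1 t0 m0] //=.
by apply: measurableU; [exact: measurableI|exact: measurableD].
Qed.

Hypothesis gen_g : (@measurable d S) `<=` <<s range g >>.

Section approximation.
Variables (mu : {measure set S -> \bar R}) (K : set S).
Hypotheses (mK : measurable K) (Kfin : mu K < +oo).

Let dist (B C : set S) := mu (K `&` (B `+` C)).

Let mdist B C : measurable B -> measurable C -> measurable (K `&` (B `+` C)).
Proof.
move=> mB mC; apply: measurableI => //.
by rewrite /setY; apply: measurableU; exact: measurableD.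
Qed.

Let dist_le B C B1 C1 B2 C2 : measurable B -> measurable C ->
  measurable B1 -> measurable C1 -> measurable B2 -> measurable C2 ->
  B `+` C `<=` (B1 `+` C1) `|` (B2 `+` C2) ->
  dist B C <= dist B1 C1 + dist B2 C2.
Proof.
move=> *; apply: le_trans (measureU2 _ (mdist _ _) (mdist _ _)) => //.
rewrite -setIUr; apply: le_measure; rewrite ?inE; [exact: mdist| |exact: setIS].
by rewrite setIUr; apply: measurableU; exact: mdist.
Qed.

(** The sets that can be approximated inside [K] form a sigma-algebra containing the generators:
    trees are closed under complement and intersection, and an increasing union is reached, up to a
    small remainder, by one of its terms. *)
Lemma dset_approx C (e : R) : measurable C -> (0 < e)%R ->
  exists t, mu (K `&` (C `+` dset g t)) < e%:E.
Proof.
pose H := [set C | measurable C /\ forall e : R, (0 < e)%R ->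
  exists t, dist C (dset g t) < e%:E].
suff : measurable `<=` H by move=> + mC e0 => /(_ C mC)[_]; exact.
apply: subset_trans gen_g _; apply: smallest_sub; last first.
  move=> _ [i _ <-]; split => // r r0.
  (* This tree denotes [g i] itself, so the distance is zero. *)
  exists (Node i (Leaf true) (Leaf false)).
  by rewrite /dist /= setIT set0D setU0 setYK setI0 measure0 lte_fin.
apply/(sigma_algebraP (fun _ _ => @subsetT _ _)).
have HI : setI_closed H.
  move=> A B [mA HA] [mB HB]; split; first exact: measurableI.
  move=> r r0; have r20 : (0 < r / 2)%R by rewrite divr_gt0.
  have [t tA] := HA _ r20; have [u uB] := HB _ r20.
  exists (dtree_and t u); rewrite dset_and [r in r%:E]splitr EFinD.
  apply: le_lt_trans (lteD tA uB).
  have mt := measurable_dset t; have mu' := measurable_dset u.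
  apply: dist_le => //; [exact: measurableI|exact: measurableI|].
  move=> x; rewrite /setY/=.
  by have [] := pselect (dset g t x); have [] := pselect (A x); tauto.
split => //.
- split => // r r0; exists (Leaf true).
  by rewrite /dist /= setYK setI0 measure0 lte_fin.
- move=> A B BA HA HB; rewrite setDE; apply: HI => //.
  have [mB {}HB] := HB; split; first exact: measurableC.
  move=> r /HB[t tr]; exists (dtree_not t); rewrite dset_not.
  rewrite (_ : dist _ _ = dist B (dset g t))// /dist; congr (mu (K `&` _)).
  by apply/seteqP; rewrite /setY; split => x /=;
    have [] := pselect (B x); have [] := pselect (dset g t x); tauto.
- move=> F ndF HF; have mF n : measurable (F n) by have [] := HF n.
  have mUF : measurable (\bigcup_n F n) by exact: bigcup_measurable.
  split => // r r0; have r20 : (0 < r / 2)%R by rewrite divr_gt0.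
  (* What [F n] misses of the union decreases to the empty set; finiteness of [mu K] makes its mass
     inside [K] tend to zero. *)
  have cv : mu (K `&` (\bigcup_n F n `\` F n)) @[n --> \oo] --> mu set0.
    rewrite (_ : set0 = \bigcap_n (K `&` (\bigcup_n F n `\` F n))); last first.
      apply/esym; rewrite -subset0 => x KFx; have [_ [[k _ Fk] _]] := KFx 0%N I.
      by have [_ [_]] := KFx k I.
    apply: nonincreasing_cvg_mu.
    - apply: le_lt_trans Kfin; apply: le_measure; rewrite ?inE//.
        by apply: measurableI => //; exact: measurableD.
    - by move=> n; apply: measurableI => //; exact: measurableD.
    - apply: bigcap_measurableType => n _.
      by apply: measurableI => //; exact: measurableD.
    - move=> n k nk; apply/subsetPset; apply: setIS; apply: setDS.
      exact/subsetPset/ndF.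
  rewrite measure0 in cv.
  have [n _ /(_ n (leqnn n)) /= nr] : \forall n \near \oo,
      mu (K `&` (\bigcup_n F n `\` F n)) < (r / 2)%:E.
    apply: (cv [set x | x < (r / 2)%:E]); apply: open_nbhs_nbhs; split.
      exact: open_ereal_lt_ereal.
    by rewrite /= lte_fin.
  have [_ /(_ _ r20)[t tr]] := HF n.
  exists t; rewrite [r in r%:E]splitr EFinD; apply: le_lt_trans (lteD nr tr).
  have mt := measurable_dset t.
  have -> : mu (K `&` (\bigcup_n F n `\` F n)) = dist (\bigcup_n F n) (F n).
    congr (mu (K `&` _)); rewrite /setY [F n `\` _](_ : _ = set0) ?setU0//.
    by rewrite -subset0 => x [Fx []]; exists n.
  apply: dist_le => // x; rewrite /setY/=.
  by have [] := pselect (F n x); tauto.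
Qed.

End approximation.

Lemma dset_le_measure (alpha beta : {measure set S -> \bar R}) K C :
  measurable K -> alpha K < +oo -> beta K < +oo -> measurable C ->
  (forall t, alpha (K `&` dset g t) <= beta (K `&` dset g t)) ->
  alpha (K `&` C) <= beta (K `&` C).
Proof.
move=> mK aK bK mC ab; apply/lee_addgt0Pr => e e0.
(* One tree has to be close to [C] for both measures at once, hence their sum. *)
pose lam : {measure set S -> \bar R} := measure_add alpha beta.
have lamE D : lam D = alpha D + beta D by exact: measure_addE.
have lamK : lam K < +oo by rewrite lamE lte_add_pinfty.
have [t] := dset_approx mK lamK mC e0; rewrite lamE => te.
have mt := measurable_dset t.
have mKY : measurable (K `&` (C `+` dset g t)).
  by apply: measurableI => //; rewrite /setY; apply: measurableU; exact: measurableD.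
have approx (z : {measure set S -> \bar R}) A B : measurable A -> measurable B ->
    A `+` B = C `+` dset g t ->
    z (K `&` A) <= z (K `&` B) + z (K `&` (C `+` dset g t)).
  move=> mA mB AB; apply: le_trans (measureU2 _ _ mKY); last exact: measurableI.
  apply: le_measure; rewrite ?inE.
  - exact: measurableI.
  - by apply: measurableU => //; exact: measurableI.
  - rewrite -AB -setIUr; apply: setIS => x Ax; rewrite /setY/=.
    by have [] := pselect (B x); tauto.
(* Going from [C] to the tree costs the [alpha]-mass of the symmetric difference in [K], going back
   costs its [beta]-mass; together this is less than [e]. *)
apply: le_trans (approx alpha C (dset g t) mC mt erefl) _.
apply: le_trans (leeD (ab t) (lexx _)) _.
apply: le_trans (leeD (approx beta (dset g t) C mt mC _) (lexx _)) _.
  by rewrite setYC.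
by rewrite -addeA leeD2l// addeC; exact/ltW.
Qed.

End dtree_measurable.

(** * Suprema over boolean combinations of generators *)

Section sup_measure_dset.
Context {d : measure_display} {S : measurableType d} {R : realType} {J : countType}.
Variable g : J -> set S.
Local Open Scope ereal_scope.

(* The list [l] assigns to a point of [E] the label [k] of the first pair
   [(k, t)] such that [dset g t] contains the point, and [greedy m l E] adds up
   the masses of the labelled pieces, each with respect to its own measure. *)
Fixpoint greedy (m : nat -> set S -> \bar R) (l : seq (nat * dtree J)) (E : set S)
    : \bar R :=
  if l is (k, t) :: l' then
    m k (E `&` dset g t) + greedy m l' (E `\` dset g t)
  else 0.

Hypothesis mg : forall i, measurable (g i).
Hypothesis gen_g : (@measurable d S) `<=` <<s range g >>.
Variable m : nat -> {measure set S -> \bar R}.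

Let mf k : set S -> \bar R := m k.
Let mu : {measure set S -> \bar R} := measure_sup m.
Let muE E : measurable E -> mu E = sup_measure mf E.
Proof. exact: measure_supE. Qed.
Let mdset t : measurable (dset g t) := measurable_dset mg t.

Lemma greedy_ge0 l E : 0 <= greedy mf l E.
Proof. by elim: l E => //= -[k t] l IHl E; rewrite adde_ge0. Qed.

Lemma greedyU l A B : measurable A -> measurable B -> A `&` B = set0 ->
  greedy mf l (A `|` B) = greedy mf l A + greedy mf l B.
Proof.
elim: l A B => [|[k t] l IHl] A B mA mB AB0 /=; first by rewrite adde0.
rewrite setIUl setDUl IHl; [|exact: measurableD|exact: measurableD|].
- rewrite /mf measureU; [exact: addeACA|exact: measurableI|exact: measurableI|].
  by rewrite setIACA AB0 set0I.
- by rewrite !setDE setIACA AB0 set0I.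
Qed.

Lemma le_greedy l A B : measurable A -> measurable B -> A `<=` B ->
  greedy mf l A <= greedy mf l B.
Proof.
move=> mA mB AB; rewrite -(setDUK AB) greedyU//; last 2 first.
  exact: measurableD.
  by rewrite setDIK.
by rewrite leeDl// greedy_ge0.
Qed.

(** The labelled pieces are disjoint parts of [E], and each has at most its mass under [mu]; points
    without a label contribute nothing. *)
Lemma greedy_le_sup_measure l E : measurable E -> greedy mf l E <= mu E.
Proof.
elim: l E => [|[k t] l IHl] E mE /=; first by [].
have mEt : measurable (E `&` dset g t) by exact: measurableI.
have mEnt : measurable (E `\` dset g t) by exact: measurableD.
rewrite -[in leRHS](setUIDK E (dset g t)) measureU//; last first.
  by apply/seteqP; split => x //= [[_ ?] [_ ?]].
apply: leeD (IHl _ mEnt).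
by have := sup_measure_ub mf k mEt; rewrite -muE.
Qed.

Variable K : set S.
Hypotheses (mK : measurable K) (Kfin : sup_measure mf K < +oo).

Let W E := ereal_sup (range (greedy mf ^~ E)).

Let W_ge0 E : 0 <= W E.
Proof.
by apply: le_ereal_sup_tmp; exists (greedy mf [::] E) => //; exists [::].
Qed.

(** The cell [C], measured by [m k], is replaced by a nearby [dset g t], and [(k, t)] is put in
    front of the list used on the rest. Both errors are bounded by the [mu]-mass of the symmetric
    difference in [K]. *)
Lemma sup_greedy_step k C E : measurable C -> measurable E -> E `<=` K ->
  m k (E `&` C) + W (E `\` C) <= W E.
Proof.
move=> mC mE EK; rewrite addeC; apply: ereal_sup_addr_le => //.
- by exists (greedy mf [::] (E `\` C)), [::].
- by move=> _ [l _ <-]; exact: greedy_ge0.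
move=> _ [l _ <-]; apply/lee_addgt0Pr => e e0.
have e20 : (0 < e / 2)%R by rewrite divr_gt0.
have Kfin' : mu K < +oo by rewrite muE.
have [t te] := dset_approx mg gen_g mK Kfin' mC e20.
have mt := mdset t.
set Y := K `&` (C `+` dset g t) in te.
have mY : measurable Y.
  by apply: measurableI => //; rewrite /setY; apply: measurableU; exact: measurableD.
have kC : m k (E `&` C) <= m k (E `&` dset g t) + (e / 2)%:E.
  apply: (@le_trans _ _ (m k (E `&` dset g t) + m k Y)); last first.
    rewrite leeD2l//; apply: le_trans (ltW te); rewrite muE//.
    exact: (sup_measure_ub mf k mY).
  apply: le_trans (measureU2 _ _ mY); last exact: measurableI.
  apply: le_measure; rewrite ?inE; first exact: measurableI.
    by apply: measurableU => //; exact: measurableI.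
  move=> x [Ex Cx]; have [tx|tx] := pselect (dset g t x); first by left.
  by right; split; [exact: EK|left].
have lC : greedy mf l (E `\` C) <= greedy mf l (E `\` dset g t) + (e / 2)%:E.
  have mEC := measurableD mE mC.
  (* The part of [E] minus [C] outside [dset g t] lies in [E] minus [dset g t]; the part inside lies
     in [Y]. *)
  rewrite -[in leLHS](setUIDK (E `\` C) (dset g t)) greedyU; last 3 first.
  - exact: measurableI.
  - exact: measurableD.
  - by apply/seteqP; split => x //= [[_ ?] [_ ?]].
  rewrite addeC; apply: leeD.
    apply: le_greedy; [exact: measurableD|exact: measurableD|].
    by move=> x /= [[]].
  apply: le_trans (ltW te); apply: le_trans (greedy_le_sup_measure _ mY).
  apply: le_greedy => //; first exact: measurableI.
  by move=> x [[Ex Cx] tx]; split; [exact: EK|right].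
apply: le_trans (leeD lC kC) _; rewrite addeACA -EFinD -splitr.
rewrite leeD2r//; apply: ereal_sup_ubound; exists ((k, t) :: l) => //=.
by rewrite addeC.
Qed.

Lemma sup_measure_dsetE E : measurable E -> E `<=` K ->
  sup_measure mf E = ereal_sup (range (greedy mf ^~ E)).
Proof.
move=> mE EK; apply/eqP; rewrite eq_le; apply/andP; split; last first.
  by apply: ge_ereal_sup => _ [l _ <-]; rewrite -muE// greedy_le_sup_measure.
rewrite {1}/sup_measure; apply: ge_ereal_sup => _ [n [C [mC tC CE ->]]].
(* Cells are written as traces on [E], so that the induction on the list of indices can shrink [E]
   by one cell at a time. *)
have {CE} -> : \sum_(i < n) ereal_sup (range (fun k => mf k (C i))) =
    \sum_(i <- index_enum 'I_n) ereal_sup (range (fun k => mf k (E `&` C i))).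
  apply: eq_bigr => i _; have -> // : E `&` C i = C i.
  by apply/setIidPr; rewrite -CE => x Cx; exists i.
(* As no index repeats, the cell removed from [E] is disjoint from all the remaining ones. *)
have := index_enum_uniq 'I_n.
elim: (index_enum _) E mE EK => [|j r IHr] E mE EK; first by rewrite big_nil W_ge0.
rewrite big_cons => /= /andP[jr ur].
have mEC : measurable (E `\` C j) by exact: measurableD.
have rest : \sum_(i <- r) ereal_sup (range (fun k => mf k (E `&` C i))) <=
    W (E `\` C j).
  apply: le_trans (IHr _ mEC _ ur); last by move=> x [] /EK.
  rewrite big_seq [leRHS]big_seq; apply: lee_sum => i ir.
  have -> : E `&` C i = (E `\` C j) `&` C i.
    apply/seteqP; split => [x [Ex Cx]|x [[]]//]; split => //; split => // Cj.
    have ij : i = j by apply: (tC i j) => //; exists x.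
    by rewrite -ij ir in jr.
  by [].
apply: le_trans (leeD (lexx _) rest) _; apply: ereal_sup_addr_le => //.
- by exists (mf 0%N (E `&` C j)), 0%N.
- by move=> _ [k _ <-]; exact: measure_ge0.
- by move=> _ [k _ <-]; exact: sup_greedy_step.
Qed.

End sup_measure_dset.

(** * Suprema of random measures *)

(** [unpickle] lists the family as a sequence, with [j0] at the codes that decode to nothing. *)
Lemma measurable_fun_ereal_sup {d : measure_display} {T : measurableType d}
    {R : realType} {J : countType} (j0 : J) (f : J -> T -> \bar R) :
  (forall j, measurable_fun setT (f j)) ->
  measurable_fun setT (fun x => ereal_sup (range (f ^~ x))).
Proof.
move=> mf; pose h n := f (odflt j0 (unpickle n)).
rewrite (_ : (fun x => _) = fun x => esups (h ^~ x) 0).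
  by apply: measurable_fun_esups => n; exact: mf.
apply/funext => x; rewrite /esups; congr ereal_sup; apply/seteqP; split.
  by move=> _ [j _ <-]; exists (pickle j) => //; rewrite /h pickleK.
by move=> _ [n _ <-]; exists (odflt j0 (unpickle n)).
Qed.

Section random_sup_measure.
Context {d d' : measure_display} {Omega : measurableType d}
  {S : measurableType d'} {R : realType} (P : probability Omega R).
Local Open Scope ereal_scope.

Lemma random_measure_sup_le (nu : nat -> Omega -> set S -> \bar R)
    (zeta : Omega -> set S -> \bar R) :
  random_measure P zeta -> (forall n, random_measure_le P (nu n) zeta) ->
  random_measure_le P (fun w => sup_measure (fun n => nu n w)) zeta.
Proof.
move=> [_ _ zmeas] /ae_foralln nuz; apply: filterS2 zmeas nuz => w [z zE] nuz C mC.
rewrite zE//; apply: sup_measure_le => n E mE; rewrite -zE//; exact: nuz.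
Qed.

Context {J : countType} (g : J -> set S).
Hypothesis mg : forall i, measurable (g i).
Hypothesis gen_g : (@measurable d' S) `<=` <<s range g >>.
Hypothesis P_complete : measure_is_complete P.

Let greedy_eq (m m' : nat -> set S -> \bar R) l E : measurable E ->
  (forall k E, measurable E -> m k E = m' k E) ->
  greedy g m l E = greedy g m' l E.
Proof.
move=> + mm'; elim: l E => //= -[k t] l IHl E mE.
have mt := measurable_dset mg t.
by rewrite IHl ?mm'//; [exact: measurableI|exact: measurableD].
Qed.

Lemma random_measure_sup (nu : nat -> Omega -> set S -> \bar R) (K : (set S)^nat) :
  (forall n, random_measure P (nu n)) ->
  (forall N, measurable (K N)) -> nondecreasing_seq K -> \bigcup_N K N = setT ->
  (forall N, {ae P, forall w, sup_measure (fun n => nu n w) (K N) < +oo}) ->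
  random_measure P (fun w => sup_measure (fun n => nu n w)).
Proof.
move=> nuM mK ndK UK Kfin.
have nu_m : {ae P, forall w, exists m : nat -> {measure set S -> \bar R},
    forall n E, measurable E -> nu n w E = m n E}.
  have : {ae P, forall w, forall n, exists m : {measure set S -> \bar R},
      forall E, measurable E -> nu n w E = m E}.
    by apply: ae_foralln => n; have [] := nuM n.
  apply: filterS => w nuw; have [m mE] := choice nuw; exists m => n E; exact: mE.
split.
- move=> w E mE; apply: le_trans (sup_measure_ub (fun n => nu n w) 0%N mE).
  by have [/(_ w E mE)] := nuM 0%N.
- move=> E mE.
  (* A countable supremum of measurable functions that agrees with the supremum of measures off a
     null set; completeness of [P] transfers its measurability. *)
  pose f w := ereal_sup (range (fun N : nat =>
    ereal_sup (range (fun l => greedy g (fun n => nu n w) l (E `&` K N))))).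
  apply: (@ae_measurable_fun _ _ _ P P_complete setT f); last first.
    apply: (measurable_fun_ereal_sup 0%N) => N.
    apply: (measurable_fun_ereal_sup [::]) => l.
    have : measurable (E `&` K N) by exact: measurableI.
    elim: l (E `&` K N) => [|[k t] l IHl] D mD /=; first exact: measurable_cst.
    have mt := measurable_dset mg t.
    apply: emeasurable_funD; last by apply: IHl; exact: measurableD.
    by have [_ + _] := nuM k; apply; exact: measurableI.
  apply: filterS2 nu_m (ae_foralln Kfin) => w [m mE'] finw _.
  have eqs D : sup_measure (fun n => nu n w) D =
      sup_measure (fun n => m n : set S -> \bar R) D.
    exact: eq_sup_measure.
  pose mu : {measure set S -> \bar R} := measure_sup m.
  have muE D : measurable D -> mu D = sup_measure (fun n => nu n w) D.
    by move=> mD; rewrite eqs; exact: measure_supE.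
  rewrite -muE// /f.
  under eq_fun => N.
    under eq_fun => l do rewrite (greedy_eq _ (measurableI _ _ mE (mK N)) mE').
    have mEK := measurableI _ _ mE (mK N).
    have mKfin := finw N; rewrite eqs in mKfin.
    rewrite -(sup_measure_dsetE mg gen_g (mK N) mKfin mEK (@subIsetr _ _ _)).
    rewrite -eqs -muE//.
    over.
  (* Both sides are the limit of the mass of the trace of [E] on [K N]: a nondecreasing sequence
     tends to its supremum, and [mu] is continuous from below. *)
  apply: (@cvg_unique _ (@ereal_hausdorff R) (mu (E `&` K N) @[N --> \oo])).
    apply: ereal_nondecreasing_cvgn => N N' NN'.
    apply: le_measure; rewrite ?inE; [exact: measurableI|exact: measurableI|].
    by apply: setIS; apply/subsetPset/ndK.
  have EK : E = \bigcup_N (E `&` K N) by rewrite -setI_bigcupr UK setIT.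
  have := @nondecreasing_cvg_mu _ _ _ mu (fun N => E `&` K N); rewrite -EK; apply=> //.
  - by move=> N; exact: measurableI.
  - by move=> N N' NN'; apply/subsetPset; apply: setIS; apply/subsetPset/ndK.
- apply: filterS nu_m => w [m mE'].
  exists (measure_sup m) => E mE; apply: esym.
  by apply: etrans (measure_supE m mE) _; apply: eq_sup_measure => n C mC; rewrite mE'.
Qed.

End random_sup_measure.

(** * Countable generation of the sigma-algebra of R_+ x U *)

Section generators.
Context {R : realType} {U : ptopologicalType}.
Notation space := (Rplus R * borel U)%type.

(** The absolute value turns every rational index into a time; all nonnegative rational times
    occur. *)
Definition Rplus_rat (q : rat) : Rplus R := `|ratr q : R|%:nng.

Lemma Rplus_leE (s t : Rplus R) : (s <= t) = (Rplus_val s <= Rplus_val t).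
Proof. by []. Qed.

Lemma measurable_Rplus_val : measurable_fun setT (@Rplus_val R).
Proof. by move=> _ B mB; exists B. Qed.

Lemma measurable_Rplus_le (t : Rplus R) : measurable [set r : Rplus R | r <= t].
Proof.
have -> : [set r : Rplus R | r <= t] = setT `&` @Rplus_val R @^-1` `]-oo, Rplus_val t].
  by rewrite setTI; apply/seteqP; split => r; rewrite /= in_itv.
exact: measurable_Rplus_val.
Qed.

Lemma measurable_Rplus_itv (s t : Rplus R) : measurable [set r : Rplus R | s < r <= t].
Proof.
have -> : [set r : Rplus R | s < r <= t] = [set r | r <= t] `\` [set r | r <= s].
  apply/seteqP; split => r /=.
    by rewrite ltNge => /andP[/negP].
  by move=> [-> /negP]; rewrite -ltNge => ->.
by apply: measurableD; exact: measurable_Rplus_le.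
Qed.

Lemma measurable_box s t (B : set U) : <<s @open U >> B ->
  measurable (box s t B : set space).
Proof. by move=> mB; apply: measurableX => //; exact: measurable_Rplus_itv. Qed.

Lemma measurable_box0 t (B : set U) : <<s @open U >> B ->
  measurable (box0 t B : set space).
Proof. by move=> mB; apply: measurableX => //; exact: measurable_Rplus_le. Qed.

Lemma continuous_borel_measurable (f : U -> R) : continuous f ->
  measurable_fun setT (f : borel U -> R).
Proof.
move=> cf; apply: (measurability _ (RGenOpens.measurableE R)).
move=> _ [_ [a [b ->]] <-]; rewrite setTI; apply: sub_sigma_algebra.
by move/continuousP: cf; apply; exact: itv_open.
Qed.

Variable f : U -> R.

Definition box_generator (j : rat + rat) : set space :=
  match j with
  | inl q => [set p | p.1 <= Rplus_rat q]
  | inr q => [set p | f p.2 <= ratr q]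
  end.

Lemma measurable_box_generator : continuous f -> forall j, measurable (box_generator j).
Proof.
move=> cf [q|q] /=.
  rewrite -[X in measurable X]setTI.
  exact: (@measurable_fst _ _ _ _ measurableT _ (measurable_Rplus_le (Rplus_rat q))).
have -> : [set p : space | f p.2 <= ratr q] =
    setT `&` snd @^-1` (f @^-1` `]-oo, ratr q]).
  by rewrite setTI; apply/seteqP; split => p; rewrite /= in_itv.
apply: measurable_snd => //.
have := continuous_borel_measurable cf measurableT
  (measurable_itv `]-oo, (ratr q : R)]).
by rewrite setTI.
Qed.

(** The sets whose preimage lies in [<<s G>>] form a sigma-algebra. It contains each ray []a, +oo[],
    since [a < h p] holds exactly when some rational lies strictly between, and these rays generate
    the Borel sets. *)
Lemma sigma_preimage_rat_rays {T : Type} (G : set (set T)) (h : T -> R) (B : set R) :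
  (forall q, <<s G >> [set p | h p <= ratr q]) -> measurable B ->
  <<s G >> (h @^-1` B).
Proof.
move=> Gq.
have sG : sigma_algebra setT <<s G >> by exact: smallest_sigma_algebra.
have : sigma_algebra setT [set B | <<s G >> (h @^-1` B)].
  split => /=.
  - by rewrite preimage_set0; exact: sigma_algebra0.
  - move=> A GA; rewrite setTD preimage_setC -setTD.
    exact: sigma_algebraCD.
  - by move=> F GF; rewrite preimage_bigcup; exact: sigma_algebra_bigcup.
move=> sH mB; have : (@RGenOInfty.G R).-sigma.-measurable B.
  by rewrite -RGenOInfty.measurableE.
move: B {mB}; apply: smallest_sub sH _ => _ [a ->] /=.
have -> : h @^-1` `]a, +oo[ =
    \bigcup_n (if unpickle n is Some q then
      if a < ratr q then ~` [set p | h p <= ratr q] else set0 else set0).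
  apply/seteqP; split => p /=; rewrite in_itv/= andbT.
    move=> /rat_in_itvoo[q]; rewrite in_itv/= => /andP[aq qh].
    exists (pickle q); [exact: I|rewrite pickleK aq /=].
    by apply/negP; rewrite -ltNge.
  move=> [n _]; case: unpickle => // q; case: ifPn => // aq /negP.
  by rewrite -ltNge; exact: lt_trans.
apply: sigma_algebra_bigcup => n; case: unpickle => [q|]; last exact: sigma_algebra0.
by case: ifPn => _; [rewrite -setTD; exact: sigma_algebraCD|exact: sigma_algebra0].
Qed.

Lemma box_generator_generate (k : R -> U) :
  {within range f, continuous k} -> cancel f k ->
  (@measurable _ space) `<=` <<s range box_generator >>.
Proof.
move=> ck fk; set G := <<s _ >>.
have sG : sigma_algebra setT G by exact: smallest_sigma_algebra.
have GI A B : G A -> G B -> G (A `&` B).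
  by move: A B; have /(sigma_algebraP (fun _ _ => @subsetT _ _))[_ _ _] := sG.
have Gfst (B : set R) : measurable B -> G [set p : space | B (Rplus_val p.1)].
  apply: (@sigma_preimage_rat_rays _ _ (fun p : space => Rplus_val p.1)) => q.
  (* For [q >= 0] the ray is a generator, the absolute value being [q]; for [q < 0] it is empty. *)
  have [q0|q0] := leP 0 q.
    apply: sub_sigma_algebra; exists (inl q) => //=.
    apply/seteqP; split => p /=; rewrite Rplus_leE /Rplus_rat /Rplus_val/= ger0_norm//;
    by rewrite ler0q.
  have -> : [set p : space | Rplus_val p.1 <= ratr q] = set0.
    apply/seteqP; split => // p /= pq.
    have : 0 <= Rplus_val p.1 by rewrite /Rplus_val.
    by move=> /le_trans/(_ pq); rewrite ler0q leNgt q0.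
  exact: sigma_algebra0.
have Gsnd (B : set U) : <<s @open U >> B -> G [set p : space | B p.2].
  have sH : sigma_algebra setT [set B : set U | G [set p : space | B p.2]].
    split => /=.
    - exact: sigma_algebra0.
    - move=> A GA; rewrite (_ : [set p | _] = setT `\` [set p : space | A p.2])//.
      exact: sigma_algebraCD.
    - move=> F GF; rewrite (_ : [set p | _] = \bigcup_n [set p : space | F n p.2])//.
      exact: sigma_algebra_bigcup.
  move=> mB; apply: (smallest_sub sH _ mB) => V oV /=.
  (* As [k] is continuous on the range of [f], the preimage of [V] under [k] is there the trace of
     an open [B'], so [V] is the preimage of [B'] under [f]. *)
  have /open_subspaceP[B' oB' BV] := (continuousP _).1 ck _ oV.
  have -> : [set p : space | V p.2] = (fun p : space => f p.2) @^-1` B'.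
    apply/seteqP; split => p /= Vp.
      have : (k @^-1` V `&` range f) (f p.2) by split; [rewrite /= fk|exists p.2].
      by rewrite -BV => -[].
    have : (B' `&` range f) (f p.2) by split => //; exists p.2.
    by rewrite BV => -[Vkf _]; rewrite -(fk p.2).
  apply: sigma_preimage_rat_rays; last exact: open_measurable.
  by move=> q; apply: sub_sigma_algebra; exists (inr q).
rewrite measurable_prod_measurableType; apply: smallest_sub => // _ [A mA [B mB <-]].
have [A' mA' AE] := mA.
have -> : A `*` B = [set p : space | A' (Rplus_val p.1)] `&` [set p | B p.2].
  by rewrite -AE setTI; apply/seteqP; split.
by apply: GI; [exact: Gfst|exact: Gsnd].
Qed.

End generators.

(** * Comparison of measures on boxes *)

Section domination_from_boxes.
Context {R : realType} {U : ptopologicalType}.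
Notation space := (Rplus R * borel U)%type.
Variables (f : U -> R) (k : R -> U).
Hypotheses (cf : continuous f) (ck : {within range f, continuous k})
  (fk : cancel f k).
Variables (alpha beta : {measure set space -> \bar R}).
Variables (q0 : rat) (V : set U).
Hypotheses (mV : <<s @open U >> V)
  (alpha_fin : (alpha (box0 (Rplus_rat q0) V) < +oo)%E)
  (beta_fin : (beta (box0 (Rplus_rat q0) V) < +oo)%E)
  (alpha0 : alpha (box0 Rplus0 V) = 0%E).
Hypothesis le_box : forall s q B, <<s @open U >> B -> B `<=` V ->
  s < Rplus_rat q -> (alpha (box s (Rplus_rat q) B) <= beta (box s (Rplus_rat q) B))%E.
Local Open Scope ereal_scope.

Let G := box_generator f.
Let mG := measurable_box_generator cf.

(** Induction on the tree, for all boxes at once: the generator at the root and its complement cut a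
    box into two boxes, each handled by one subtree. *)
Let le_box_dset t s q B : <<s @open U >> B -> B `<=` V ->
  alpha (box s (Rplus_rat q) B `&` dset G t) <=
  beta (box s (Rplus_rat q) B `&` dset G t).
Proof.
have mf : measurable_fun setT (f : borel U -> R) by exact: continuous_borel_measurable.
have mray q' : <<s @open U >> [set u | f u <= ratr q']%R.
  have -> : [set u | f u <= ratr q']%R = setT `&` f @^-1` `]-oo, ratr q'].
    by rewrite setTI; apply/seteqP; split => u; rewrite /= in_itv.
  exact: mf.
elim: t s q B => [[]|j t1 IH1 t0 IH0] s q B mB BV /=.
(* Cutting may produce an empty box, to which [le_box] does not apply. *)
- rewrite !setIT; have [sq|qs] := ltP s (Rplus_rat q); first exact: le_box.
  have -> : box s (Rplus_rat q) B = set0 :> set space.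
    rewrite -subset0 => -[r u] [/= /andP[sr rq] _].
    by have := le_lt_trans (le_trans rq qs) sr; rewrite ltxx.
  by rewrite !measure0.
- by rewrite !setI0 !measure0.
have mbox : measurable (box s (Rplus_rat q) B : set space) by exact: measurable_box.
have m1 := measurable_dset mG t1; have m0 := measurable_dset mG t0.
have splitE (z : {measure set space -> \bar R}) :
    z (box s (Rplus_rat q) B `&` (G j `&` dset G t1 `|` dset G t0 `\` G j)) =
    z ((box s (Rplus_rat q) B `&` G j) `&` dset G t1) +
    z ((box s (Rplus_rat q) B `\` G j) `&` dset G t0).
  rewrite setIUr measureU.
  - rewrite setIA; congr (_ + z _).
    by apply/seteqP; split => x /=; tauto.
  - by apply: measurableI => //; apply: measurableI.
  - by apply: measurableI => //; apply: measurableD.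
  - by apply/seteqP; split => x //= [[_ [? _]] [_ [_ ?]]].
rewrite !splitE; case: j {splitE} => [q'|q'].
(* The right end becomes the smaller of two rational times, so it stays of the form required by
   [le_box]; the left end of the complementary piece is a maximum and may be any time. *)
- have -> : box s (Rplus_rat q) B `&` G (inl q') =
      box s (if (Rplus_rat q' <= Rplus_rat q :> Rplus R)%R then Rplus_rat q'
             else Rplus_rat q) B.
    apply/seteqP; split => -[r u]; rewrite /box /=; case: ifPn => qq.
    + by move=> [[/= /andP[-> _] Bu] ->].
    + by move=> [[/= /andP[-> ->] Bu] _].
    + by move=> [/= /andP[-> rq'] Bu]; split; [split => //=; exact: le_trans qq|].
    + move=> [/= /andP[-> rq] Bu]; split; first by split.
      by apply: le_trans rq _; rewrite ltW// ltNge.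
  have -> : box s (Rplus_rat q) B `\` G (inl q') =
      box (Num.max s (Rplus_rat q')) (Rplus_rat q) B.
    apply/seteqP; split => -[r u]; rewrite /box /=.
      move=> [[/= /andP[sr rq] Bu] /negP]; rewrite -ltNge => q'r; split => //=.
      by rewrite gt_max sr q'r.
    move=> [/=]; rewrite gt_max => /andP[/andP[sr q'r] rq] Bu; split.
      by split => //=; rewrite sr.
    by apply/negP; rewrite -ltNge.
  by apply: leeD; [case: ifPn => _; exact: IH1|exact: IH0].
- have -> : box s (Rplus_rat q) B `&` G (inr q') =
      box s (Rplus_rat q) (B `&` [set u | f u <= ratr q']%R).
    by apply/seteqP; split => -[r u] /=; rewrite /box/=; tauto.
  have -> : box s (Rplus_rat q) B `\` G (inr q') =
      box s (Rplus_rat q) (B `\` [set u | f u <= ratr q']%R).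
    by apply/seteqP; split => -[r u] /=; rewrite /box/=; tauto.
  apply: leeD.
    apply: IH1; last by move=> u [] /BV.
    exact: (@measurableI _ (borel U) _ _ mB (mray q')).
  apply: IH0; last by move=> u [] /BV.
  exact: (@measurableD _ (borel U) _ _ mB (mray q')).
Qed.

(** The slice at time zero is [alpha]-null. On the remaining half-open box, which has finite mass
    for both measures, the comparison passes from trees to [C]. *)
Lemma box_domination C : measurable C -> alpha (C `&` box0 (Rplus_rat q0) V) <= beta C.
Proof.
move=> mC; set T := Rplus_rat q0.
have mb : measurable (box Rplus0 T V : set space) by exact: measurable_box.
have mb0 t : measurable (box0 t V : set space) by exact: measurable_box0.
have bb0 : box Rplus0 T V `<=` box0 T V by move=> -[r u] [/= /andP[_ rT] Vu].
have fin (z : {measure set space -> \bar R}) :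
    z (box0 T V) < +oo -> z (box Rplus0 T V) < +oo.
  by apply: le_lt_trans; apply: le_measure; rewrite ?inE.
have gen := box_generator_generate ck fk.
have CT : C `&` box0 T V `<=` (box Rplus0 T V `&` C) `|` box0 Rplus0 V.
  move=> -[r u] [Cru [/= rT Vu]].
  have [r0|r0] := leP r Rplus0; first by right.
  by left; split => //; split => //=; rewrite r0.
apply: le_trans (_ : alpha (box Rplus0 T V `&` C) <= _); last first.
  apply: le_trans (dset_le_measure mG gen mb (fin _ alpha_fin) (fin _ beta_fin) mC _) _.
    by move=> t; exact: le_box_dset.
  by apply: le_measure; rewrite ?inE//; exact: measurableI.
rewrite -[leRHS]adde0 -alpha0.
apply: le_trans (measureU2 _ _ (mb0 _)); last exact: measurableI.
apply: le_measure; rewrite ?inE//; first exact: measurableI.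
by apply: measurableU => //; exact: measurableI.
Qed.

End domination_from_boxes.

(** * Quadratic variation *)

Lemma ae_forall_countable {d : measure_display} {T : measurableType d} {R : realType}
    (P : {measure set T -> \bar R}) {J : countType} (Q : J -> T -> Prop) :
  (forall j, {ae P, forall w, Q j w}) -> {ae P, forall w, forall j, Q j w}.
Proof.
move=> PQ; have : {ae P, forall w, forall n j, unpickle n = Some j -> Q j w}.
  apply: ae_foralln => n; case: (unpickle n) => [j|]; last exact: aeW.
  by apply: filterS (PQ j) => w Qj _ [<-].
by apply: filterS => w QP j; apply: (QP (pickle j)); exact: pickleK.
Qed.

Lemma ae_probability1 {d : measure_display} {T : measurableType d} {R : realType}
    (P : probability T R) (E : set T) :
  measurable E -> P E = 1%E -> {ae P, forall w, E w}.
Proof.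
move=> mE PE; exists (~` E); split => //; first exact: measurableC.
by rewrite probability_setC// PE subee.
Qed.

Lemma random_measure_le_anti {d d' : measure_display} {Omega : measurableType d}
    {S : measurableType d'} {R : realType} (P : probability Omega R)
    (eta zeta : Omega -> set S -> \bar R) :
  random_measure_le P eta zeta -> random_measure_le P zeta eta ->
  random_measure_eq P eta zeta.
Proof.
apply: filterS2 => w ez ze C mC; apply/eqP; rewrite eq_le.
by rewrite ez// ze.
Qed.

Section intensities.
Context {R : realType} {d : measure_display} {Omega : measurableType d}
  (P : probability Omega R) (F : Rplus R -> set (set Omega))
  {U : ptopologicalType} (A : set (set U)) {X : completeNormedModType R}
  (M : Rplus R -> set U -> dual X -> Omega -> R).
Local Open Scope ereal_scope.

Lemma mvm_exhaustion (x : dual X) : cylindrical_orthogonal_mvm P F A M ->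
  exists Un : (set U)^nat,
    [/\ forall n, <<s @open U >> (Un n), nondecreasing_seq Un,
        \bigcup_n Un n = setT &
        forall n B, <<s @open U >> B -> B `<=` Un n -> A B].
Proof.
move=> [_ _ _ Msf _].
(* The exhaustion is part of the condition at each positive time; time one is chosen. *)
have [] := Msf (1%:nng : {nonneg R})%R x ltr01.
by move=> _ _ [Un [[mUn [ndUn UUn] UnA _] _ _]]; exists Un.
Qed.

Lemma intensity_measure_fin x (nu : Omega -> set (Rplus R * borel U) -> \bar R) t B :
  is_intensity_measure P F A M x nu -> A B ->
  {ae P, forall w, nu w (box0 t B) < +oo}.
Proof.
move=> [_ _ _ nuV] /nuV[V _ /(_ t)].
by apply: filterS => w ->; rewrite ltry.
Qed.

Lemma intensity_measure0 x (nu : Omega -> set (Rplus R * borel U) -> \bar R) B :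
  is_intensity_measure P F A M x nu -> A B ->
  {ae P, forall w, nu w (box0 Rplus0 B) = 0}.
Proof.
move=> [_ _ _ nuV] /nuV[V [_ _ V0 _] /(_ Rplus0)].
by apply: filterS2 V0 => w V0 ->; rewrite V0.
Qed.

Variables (nu : dual X -> Omega -> set (Rplus R * borel U) -> \bar R)
  (xn : nat -> dual X).

(** For fixed [x] the exceptional set depends only on the end time of the box, so rational end times
    leave countably many null sets. *)
Lemma sequentially_bounded_rat x : sequentially_bounded P A nu ->
  dense_in_dual_sphere xn -> `|x|%R = 1%R ->
  {ae P, forall w, forall q s B, (s < Rplus_rat q)%R -> A B ->
    nu x w (box s (Rplus_rat q) B) <=
    ereal_sup (range (fun n => nu (xn n) w (box s (Rplus_rat q) B)))}.
Proof.
move=> nu_bounded xnd x1; apply: ae_forall_countable => q.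
have [q0|q0] := ltP Rplus0 (Rplus_rat q : Rplus R).
  have [Ox [mOx POx OxP]] := nu_bounded xn x _ xnd x1 q0.
  by apply: filterS (ae_probability1 mOx POx) => w Ow s B sq AB; exact: OxP.
(* No time lies below [Rplus_rat q] when the latter is at most zero. *)
apply: aeW => w s B sq _; have := lt_le_trans sq q0.
by rewrite ltNge Rplus_leE /Rplus_val/= ge0.
Qed.

End intensities.

Theorem theorem5p8 (R : realType) (d : measure_display)
    (Omega : measurableType d) (P : probability Omega R)
    (F : Rplus R -> set (set Omega)) (U : ptopologicalType) (A : set (set U))
    (X : completeNormedModType R)
    (M : Rplus R -> set U -> dual X -> Omega -> R)
    (nu : dual X -> Omega -> set (Rplus R * borel U) -> \bar R)
    (xn : nat -> dual X)
    (P_complete : measure_is_complete P)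
    (F_filtration : is_filtration F)
    (F_usual : usual_conditions P F)
    (U_hausdorff : hausdorff_space U)
    (U_Lusin : homeomorphic_to_Borel_subset_of_R R U)
    (A_ring : ring_of_Borel_sets A)
    (dual_separable : separable (dual X))
    (M_mvm : cylindrical_orthogonal_mvm P F A M)
    (nu_intensity : forall x, is_intensity_measure P F A M x (nu x))
    (xn_dense : dense_in_dual_sphere xn)
    (mu := fun w => sup_measure (fun n => nu (xn n) w))
    (mu_finite : forall t B, A B -> {ae P, forall w, (mu w (box0 t B) < +oo)%E})
    (nu_bounded : sequentially_bounded P A nu) :
  is_quadratic_variation P A nu mu /\
  forall eta, is_quadratic_variation P A nu eta -> random_measure_eq P eta mu.
Proof.
have [f [k [_ cf ck fk]]] := U_Lusin.
have [Un [mUn ndUn UUn UnA]] := mvm_exhaustion (xn 0%N) M_mvm.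
have AUn n : A (Un n) by apply: (UnA n).
have mg := measurable_box_generator cf.
have gen := box_generator_generate ck fk.
(* Integer times are of the form [Rplus_rat _], as [box_domination] requires. *)
pose T (N : nat) : Rplus R := Rplus_rat N%:R.
have TE N : Rplus_val (T N) = N%:R by rewrite /Rplus_val/= ratr_nat normr_nat.
pose K N : set (Rplus R * borel U) := box0 (T N) (Un N).
have mK N : measurable (K N) by exact: measurable_box0.
have ndK : nondecreasing_seq K.
  move=> N N' NN'; apply/subsetPset => -[r u] [/= rN uN]; split => /=.
    by apply: le_trans rN _; rewrite Rplus_leE !TE ler_nat.
  by move/subsetPset: (ndUn _ _ NN'); apply.
have UK : \bigcup_N K N = setT.
  rewrite -subTset => -[r u] _.
  have [n _ un] : (\bigcup_n Un n) u by rewrite UUn.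
  (* [n] takes care of the point [u], the Archimedean bound of the time [r]. *)
  pose N := maxn n (Num.bound (Rplus_val r)).
  exists N => //; split => /=.
    rewrite Rplus_leE TE; apply: (@le_trans _ _ (Num.bound (Rplus_val r))%:R).
      by apply/ltW/archi_boundP; rewrite /Rplus_val.
    by rewrite ler_nat leq_maxr.
  by move/subsetPset: (ndUn n N (leq_maxl _ _)); exact.
have nu_random x : random_measure P (nu x) by have [] := nu_intensity x.
have mu_random : random_measure P mu.
  apply: (random_measure_sup mg gen P_complete (K := K)) => // N.
  exact: mu_finite (AUn N).
have mu_dominates x : `|x| = 1 -> random_measure_le P (nu x) mu.
  move=> x1.
  have nu_fin : {ae P, forall w, forall N, (nu x w (K N) < +oo)%E}.
    by apply: ae_foralln => N; exact: intensity_measure_fin (nu_intensity x) (AUn N).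
  have nu0 : {ae P, forall w, forall N, (nu x w (box0 Rplus0 (Un N)) = 0)%E}.
    by apply: ae_foralln => N; exact: intensity_measure0 (nu_intensity x) (AUn N).
  have mu_fin : {ae P, forall w, forall N, (mu w (K N) < +oo)%E}.
    by apply: ae_foralln => N; exact: mu_finite (AUn N).
  have [_ _ nu_meas] := nu_random x; have [_ _ mu_meas] := mu_random.
  have nu_le := sequentially_bounded_rat nu_bounded xn_dense x1.
  apply: filterS2 (filterI nu_meas mu_meas)
    (filterI nu_le (filterI nu_fin (filterI nu0 mu_fin))).
  move=> w [[alpha alphaE] [beta betaE]] [le_w [alpha_fin [alpha0 beta_fin]]] C mC.
  rewrite alphaE// betaE//.
  (* Continuity from below reduces the comparison to the traces of [C] on the sets [K N], which have
     finite mass for both measures. *)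
  have cv : alpha (C `&` K N) @[N --> \oo] --> alpha C.
    have CK : C = \bigcup_N (C `&` K N) by rewrite -setI_bigcupr UK setIT.
    have := @nondecreasing_cvg_mu _ _ _ alpha (fun N => C `&` K N).
    rewrite -CK; apply=> //; first by move=> N; exact: measurableI.
    by move=> N N' NN'; apply/subsetPset; apply: setIS; apply/subsetPset/ndK.
  rewrite -(cvg_lim _ cv)//; apply: lime_le; first by apply/cvg_ex; exists (alpha C).
  apply: nearW => N.
  apply: (box_domination cf ck fk) => //.
  - by have := alpha_fin N; rewrite alphaE.
  - by have := beta_fin N; rewrite betaE.
  - by rewrite -alphaE//; exact: measurable_box0.
  move=> s q B mB BUn sq; have mbox := measurable_box s (Rplus_rat q) mB.
  (* Sequential boundedness gives a supremum of numbers, each of which is at most the supremum of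
     measures on the same box. *)
  rewrite -alphaE// -betaE//; apply: le_trans (le_w q s B sq (UnA N B mB BUn)) _.
  apply: ge_ereal_sup => _ [n _ <-].
  exact: (sup_measure_ub (fun n => nu (xn n) w)).
have mu_least zeta : random_measure P zeta ->
    (forall x : dual X, `|x| = 1 -> random_measure_le P (nu x) zeta) ->
    random_measure_le P mu zeta.
  move=> zr nuz; apply: random_measure_sup_le => // n; apply: nuz.
  by have [] := xn_dense.
split.
  by split => // zeta [zr nuz] _; exact: mu_least.
(* [mu] lies below the dominating [eta]; as [mu] dominates too, minimality of [eta] gives the
   reverse inequality. *)
move=> eta [_ [eta_r nu_eta] eta_min].
have mu_eta := mu_least _ eta_r nu_eta.
by apply: random_measure_le_anti => //; exact: eta_min.
Qed.
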